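(* Define $h:\mathbb{R}\to\mathbb{R}$ by $$h(x) = \frac{-1}{\sqrt[3]{1024}}\left\{9x\left(\sqrt[3]{\sqrt{9x^2+4}-3x}-\sqrt[3]{\sqrt{9x^2+4}+3x}\right)+\sqrt{9x^2+4}\left(\sqrt[3]{\sqrt{9x^2+4}-3x}+\sqrt[3]{\sqrt{9x^2+4}+3x}\right)\right\}.$$ Then the function $u:\mathbb{R}^2\to\mathbb{R}$, $u(x,y)=h(x)-h(y)$, is of class $C^2$ on $\mathbb{R}^2$, is not an affine linear function, and satisfies $$(1+u_x^2)\,u_{xx}+2u_xu_y\,u_{xy}+(1+u_y^2)\,u_{yy}=0$$ at every point of $\mathbb{R}^2$. In particular, this equation does not have the Bernstein property.
   Context: Subscripts denote partial derivatives. A second-order partial differential equation for a function $u$ of two real variables has the Bernstein property if every $C^2$-solution $u:\mathbb{R}^2\to\mathbb{R}$ defined on all of $\mathbb{R}^2$ is necessarily affine linear, i.e. of the form $u(x,y)=ax+by+c$ with $a,b,c\in\mathbb{R}$. *)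

(* Defs.v *)
From Stdlib Require Import Reals Lra.
From Coquelicot Require Import Coquelicot.
Open Scope R_scope.

Definition dx (f : R -> R -> R) : R -> R -> R :=
  fun x y => Derive (fun t => f t y) x.

Definition dy (f : R -> R -> R) : R -> R -> R :=
  fun x y => Derive (fun t => f x t) y.

(* [Derive] is total, so the existence of the partial derivatives has to be
   required explicitly. *)
Fixpoint class_C (n : nat) (f : R -> R -> R) : Prop :=
  match n with
  | O => forall x y, continuity_2d_pt f x y
  | S m =>
      (forall x y, ex_derive (fun t => f t y) x /\ ex_derive (fun t => f x t) y)
      /\ class_C m (dx f) /\ class_C m (dy f)
  end.

Definition affine_linear (f : R -> R -> R) : Prop :=
  exists a b c : R, forall x y, f x y = a * x + b * y + c.

(* A second-order equation F(x, y, u, u_x, u_y, u_xx, u_xy, u_yy) = 0 is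
   represented by F, with arguments in this order. *)
Definition pde2 : Type := R -> R -> R -> R -> R -> R -> R -> R -> R.

Definition satisfies (F : pde2) (u : R -> R -> R) : Prop :=
  forall x y,
    F x y (u x y) (dx u x y) (dy u x y)
      (dx (dx u) x y) (dy (dx u) x y) (dy (dy u) x y) = 0.

Definition bernstein_property (F : pde2) : Prop :=
  forall u : R -> R -> R, class_C 2 u -> satisfies F u -> affine_linear u.

(* The real cube root for positive arguments only, see [cbrt_spec]; in [h] all
   arguments are positive, see [h_arg_pos]. *)
Definition cbrt (x : R) : R := Rpower x (/ 3).

Lemma cbrt_spec (x : R) : 0 < x -> 0 < cbrt x /\ cbrt x ^ 3 = x.
Proof.
  intros Hx.
  assert (Hp : 0 < cbrt x) by apply exp_pos.
  split; [exact Hp|].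
  rewrite <- (Rpower_pow 3 (cbrt x) Hp). unfold cbrt.
  rewrite Rpower_mult.
  replace (/ 3 * INR 3) with 1 by (simpl; field).
  now apply Rpower_1.
Qed.

Lemma h_arg_pos (x : R) :
  0 < sqrt (9 * x ^ 2 + 4) - 3 * x /\ 0 < sqrt (9 * x ^ 2 + 4) + 3 * x.
Proof.
  assert (H : Rabs (3 * x) < sqrt (9 * x ^ 2 + 4)).
  { rewrite <- sqrt_Rsqr_abs. apply sqrt_lt_1_alt. unfold Rsqr. nra. }
  apply Rabs_def2 in H. lra.
Qed.

Definition h (x : R) : R :=
  -1 / cbrt 1024 *
  (9 * x * (cbrt (sqrt (9 * x ^ 2 + 4) - 3 * x)
            - cbrt (sqrt (9 * x ^ 2 + 4) + 3 * x))
   + sqrt (9 * x ^ 2 + 4) * (cbrt (sqrt (9 * x ^ 2 + 4) - 3 * x)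
                             + cbrt (sqrt (9 * x ^ 2 + 4) + 3 * x))).

(* Main.v *)
Require Import Defs.
From Stdlib Require Import Reals Lra FunctionalExtensionality.
From Coquelicot Require Import Coquelicot.
Open Scope R_scope.

(** For a function of the form [u x y = f x - f y] the mixed derivative
    vanishes, and the equation reads [(1 + f' x ^ 2) * f'' x =
    (1 + f' y ^ 2) * f'' y].  So every [f] for which [(1 + f' ^ 2) * f''] is
    constant gives a solution.  With the constant [1] and [f' 0 = 0] this
    means that [w = f'] solves the cubic [w ^ 3 + 3 * w = 3 * x], whose real
    root is given by Cardano's formula; [h] is a primitive of that root.

    To check this, let [s = sqrt (9 x^2 + 4)] and let [A], [B] be the cube
    roots of [s - 3 x] and [s + 3 x].  They satisfy [A B = q] with [q] the cube
    root of [4], and [A' = - A / s], [B' = B / s].  These rules make all terms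
    of [h'] with a denominator cancel, which leaves
    [h' = 2 (B - A) / q^2] ([is_derive_h]), and then
    [(1 + h'^2) h'' = (A + B) (A^2 - A B + B^2) / (2 s)
    = (A^3 + B^3) / (2 s) = 1] ([is_derive_slope]).  Since
    [h'' = 1 / (1 + h'^2)], the function [h] is of class [C^2], and [h''] is
    nowhere zero, so [u] is not affine. *)

(** * Functions of separated variables *)

Lemma dx_separated (p q p' : R -> R) :
  (forall x, is_derive p x (p' x)) ->
  dx (fun x y => p x - q y) = fun x _ => p' x.
Proof.
  intros Hp. extensionality x; extensionality y.
  apply is_derive_unique.
  replace (p' x) with (minus (p' x) 0) by apply Rminus_0_r.
  apply @is_derive_minus; [apply Hp | apply @is_derive_const].
Qed.

Lemma dy_separated (p q q' : R -> R) :
  (forall y, is_derive q y (q' y)) ->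
  dy (fun x y => p x - q y) = fun _ y => - q' y.
Proof.
  intros Hq. extensionality x; extensionality y.
  apply is_derive_unique.
  replace (- q' y) with (minus 0 (q' y)) by apply Rminus_0_l.
  apply @is_derive_minus; [apply @is_derive_const | apply Hq].
Qed.

Section SeparatedSolution.

Variables f g g' : R -> R.
Hypothesis f_derive : forall x, is_derive f x (g x).
Hypothesis g_derive : forall x, is_derive g x (g' x).

Let u (x y : R) : R := f x - f y.

Lemma dx_difference : dx u = fun x _ => g x.
Proof. now apply dx_separated. Qed.

Lemma dy_difference : dy u = fun _ y => - g y.
Proof. now apply dy_separated. Qed.

Lemma dxx_difference : dx (dx u) = fun x _ => g' x.
Proof.
  rewrite dx_difference. extensionality x; extensionality y.
  now apply is_derive_unique.
Qed.

Lemma dyx_difference : dy (dx u) = fun _ _ => 0.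
Proof.
  rewrite dx_difference. extensionality x; extensionality y.
  apply (Derive_const (g x)).
Qed.

Lemma dxy_difference : dx (dy u) = fun _ _ => 0.
Proof.
  rewrite dy_difference. extensionality x; extensionality y.
  apply (Derive_const (- g y)).
Qed.

Lemma dyy_difference : dy (dy u) = fun _ y => - g' y.
Proof.
  rewrite dy_difference. extensionality x; extensionality y.
  apply is_derive_unique. now apply @is_derive_opp.
Qed.

Lemma difference_class_C2 : (forall x, continuous g' x) -> class_C 2 u.
Proof.
  intros g'_cont.
  assert (g'_cont_pt : forall x, continuity_pt g' x).
  { intros x. apply continuity_pt_filterlim, g'_cont. }
  split; [|split; [split; [|split]|split; [|split]]].
  - intros x y; split; eexists; unfold u;
      apply @is_derive_minus;
      (apply f_derive || apply @is_derive_const).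
  - rewrite dx_difference. intros x y; split.
    + now exists (g' x).
    + apply @ex_derive_const.
  - rewrite dxx_difference. intros x y.
    apply (continuity_1d_2d_pt_comp g' (fun a _ => a));
      [apply g'_cont_pt | apply continuity_2d_pt_id1].
  - rewrite dyx_difference. intros x y. apply continuity_2d_pt_const.
  - rewrite dy_difference. intros x y; split.
    + apply @ex_derive_const.
    + apply @ex_derive_opp. now exists (g' y).
  - rewrite dxy_difference. intros x y. apply continuity_2d_pt_const.
  - rewrite dyy_difference. intros x y.
    apply continuity_2d_pt_opp.
    apply (continuity_1d_2d_pt_comp g' (fun _ b => b));
      [apply g'_cont_pt | apply continuity_2d_pt_id2].
Qed.

(** On the line [y = 0] an affine [u] gives [f] a constant slope. *)
Lemma difference_affine_linear : affine_linear u -> forall x, g' x = 0.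
Proof.
  intros (a & b & c & Hu) x.
  assert (Hg : forall t, a = g t).
  { intros t. rewrite <- (is_derive_unique _ _ _ (f_derive t)).
    symmetry. apply is_derive_unique.
    apply is_derive_ext with (fun r => a * r + c + f 0).
    - intros r. generalize (Hu r 0). unfold u. lra.
    - auto_derive; [exact I | ring]. }
  rewrite <- (is_derive_unique _ _ _ (g_derive x)).
  apply is_derive_unique.
  apply is_derive_ext with (fun _ => a); [exact Hg | apply @is_derive_const].
Qed.

End SeparatedSolution.

(** * The first two derivatives of h *)

Lemma cbrt_pos (x : R) : 0 < cbrt x.
Proof. apply exp_pos. Qed.

Lemma cbrt_cube (x : R) : 0 < x -> cbrt x ^ 3 = x.
Proof. intros Hx. apply (cbrt_spec x Hx). Qed.

Lemma cbrt_mult (x y : R) : 0 < x -> 0 < y -> cbrt x * cbrt y = cbrt (x * y).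
Proof. intros Hx Hy. now apply Rpower_mult_distr. Qed.

Lemma cbrt_1024 : cbrt 1024 = 4 * cbrt 4 ^ 2.
Proof.
  replace 1024 with (4 * 4 * (4 * (4 * 4))) by ring.
  rewrite <- !cbrt_mult by lra.
  pose proof (cbrt_cube 4 ltac:(lra)) as H4. nra.
Qed.

Lemma is_derive_cbrt (x : R) : 0 < x -> is_derive cbrt x (cbrt x / (3 * x)).
Proof.
  intros Hx. unfold cbrt, Rpower.
  auto_derive; [exact Hx | field; lra].
Qed.

Definition disc (x : R) : R := sqrt (9 * x ^ 2 + 4).

Definition cardanoA (x : R) : R := cbrt (disc x - 3 * x).

Definition cardanoB (x : R) : R := cbrt (disc x + 3 * x).

Lemma disc_pos (x : R) : 0 < disc x.
Proof. apply sqrt_lt_R0. nra. Qed.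

Lemma disc_sqr (x : R) : disc x ^ 2 = 9 * x ^ 2 + 4.
Proof. apply pow2_sqrt. nra. Qed.

Lemma is_derive_disc (x : R) : is_derive disc x (9 * x / disc x).
Proof.
  pose proof (disc_pos x) as Hs. unfold disc in *.
  auto_derive; [nra|].
  replace (9 * (x * (x * 1)) + 4) with (9 * x ^ 2 + 4) by ring.
  field. lra.
Qed.

Lemma cardanoA_cube (x : R) : cardanoA x ^ 3 = disc x - 3 * x.
Proof. apply cbrt_cube, h_arg_pos. Qed.

Lemma cardanoB_cube (x : R) : cardanoB x ^ 3 = disc x + 3 * x.
Proof. apply cbrt_cube, h_arg_pos. Qed.

Lemma cardanoAB (x : R) : cardanoA x * cardanoB x = cbrt 4.
Proof.
  unfold cardanoA, cardanoB. rewrite cbrt_mult by apply h_arg_pos.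
  f_equal. pose proof (disc_sqr x). nra.
Qed.

(** The logarithmic derivative of [disc x - 3 x] is [- 3 / disc x], because
    its derivative is [9 x / disc x - 3 = - 3 (disc x - 3 x) / disc x]. *)
Lemma is_derive_cardanoA (x : R) :
  is_derive cardanoA x (- cardanoA x / disc x).
Proof.
  pose proof (disc_pos x) as Hs.
  pose proof (proj1 (h_arg_pos x)) as Ha. fold (disc x) in Ha.
  replace (- cardanoA x / disc x)
    with (scal (9 * x / disc x - 3) (cardanoA x / (3 * (disc x - 3 * x))))
    by (unfold scal; simpl; unfold mult; simpl; field; lra).
  apply (is_derive_comp cbrt (fun t => disc t - 3 * t)).
  - now apply is_derive_cbrt.
  - apply @is_derive_minus; [apply is_derive_disc|].
    auto_derive; [exact I | ring].
Qed.

Lemma is_derive_cardanoB (x : R) : is_derive cardanoB x (cardanoB x / disc x).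
Proof.
  pose proof (disc_pos x) as Hs.
  pose proof (proj2 (h_arg_pos x)) as Hb. fold (disc x) in Hb.
  replace (cardanoB x / disc x)
    with (scal (9 * x / disc x + 3) (cardanoB x / (3 * (disc x + 3 * x))))
    by (unfold scal; simpl; unfold mult; simpl; field; lra).
  apply (is_derive_comp cbrt (fun t => disc t + 3 * t)).
  - now apply is_derive_cbrt.
  - apply @is_derive_plus; [apply is_derive_disc|].
    auto_derive; [exact I | ring].
Qed.

(** Cardano's expression for the real root [w] of [w ^ 3 + 3 * w = 3 * x]. *)
Definition slope (x : R) : R := 2 * (cardanoB x - cardanoA x) / cbrt 4 ^ 2.

Lemma is_derive_h (x : R) : is_derive h x (slope x).
Proof.
  pose proof (disc_pos x) as Hs.
  pose proof (cbrt_pos 4) as Hq.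
  apply is_derive_ext with (fun t => -1 / cbrt 1024 *
    (9 * t * (cardanoA t - cardanoB t)
     + disc t * (cardanoA t + cardanoB t))); [reflexivity|].
  rewrite cbrt_1024.
  pose proof (is_derive_unique _ _ _ (is_derive_disc x)) as Ds.
  pose proof (is_derive_unique _ _ _ (is_derive_cardanoA x)) as DA.
  pose proof (is_derive_unique _ _ _ (is_derive_cardanoB x)) as DB.
  assert (Es : ex_derive disc x) by (eexists; apply is_derive_disc).
  assert (EA : ex_derive cardanoA x) by (eexists; apply is_derive_cardanoA).
  assert (EB : ex_derive cardanoB x) by (eexists; apply is_derive_cardanoB).
  auto_derive.
  - exact (conj EA (conj EB (conj Es (conj EA (conj EB I))))).
  - change (fun t => disc t) with disc.
    change (fun t => cardanoA t) with cardanoA.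
    change (fun t => cardanoB t) with cardanoB.
    rewrite Ds, DA, DB. unfold slope. field. lra.
Qed.

(** By the product rules for [cardanoA] and [cardanoB], the derivative is
    [2 (A + B) / (q^2 s)], and [1 + slope^2 = (A^2 - A B + B^2) / q] because
    [A B = q] and [q^3 = 4]; the product of the two is
    [2 (A^3 + B^3) / (q^3 s) = 1]. *)
Lemma is_derive_slope (x : R) : is_derive slope x (/ (1 + slope x ^ 2)).
Proof.
  pose proof (disc_pos x) as Hs.
  pose proof (cbrt_pos 4) as Hq.
  pose proof (cbrt_cube 4 ltac:(lra)) as Hq3.
  replace (/ (1 + slope x ^ 2))
    with (2 * (cardanoA x + cardanoB x) / (cbrt 4 ^ 2 * disc x)).
  - pose proof (is_derive_unique _ _ _ (is_derive_cardanoA x)) as DA.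
    pose proof (is_derive_unique _ _ _ (is_derive_cardanoB x)) as DB.
    assert (EA : ex_derive cardanoA x) by (eexists; apply is_derive_cardanoA).
    assert (EB : ex_derive cardanoB x) by (eexists; apply is_derive_cardanoB).
    unfold slope. auto_derive.
    + exact (conj EB (conj EA I)).
    + change (fun t => cardanoA t) with cardanoA.
      change (fun t => cardanoB t) with cardanoB.
      rewrite DA, DB. field. lra.
  - assert (Hsum : cardanoA x ^ 3 + cardanoB x ^ 3 = 2 * disc x).
    { rewrite cardanoA_cube, cardanoB_cube. ring. }
    assert (Hw : 1 + slope x ^ 2
      = (cardanoA x ^ 2 - cardanoA x * cardanoB x + cardanoB x ^ 2) / cbrt 4).
    { pose proof (cardanoAB x) as HAB. unfold slope.
      replace ((2 * (cardanoB x - cardanoA x) / cbrt 4 ^ 2) ^ 2)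
        with (4 * (cardanoB x - cardanoA x) ^ 2 / (cbrt 4 * cbrt 4 ^ 3))
        by (field; lra).
      rewrite Hq3.
      apply Rmult_eq_reg_r with (cbrt 4); [|lra].
      field_simplify; [|lra|lra]. rewrite <- HAB. field. }
    assert (Hpos : 0 < 1 + slope x ^ 2) by nra.
    apply Rmult_eq_reg_r with (1 + slope x ^ 2); [|lra].
    rewrite Rinv_l by lra. rewrite Hw.
    replace (2 * (cardanoA x + cardanoB x) / (cbrt 4 ^ 2 * disc x) *
      ((cardanoA x ^ 2 - cardanoA x * cardanoB x + cardanoB x ^ 2) / cbrt 4))
      with (2 * (cardanoA x ^ 3 + cardanoB x ^ 3) / (cbrt 4 ^ 3 * disc x))
      by (field; lra).
    rewrite Hsum, Hq3. field. lra.
Qed.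

(** The formula [w' = / (1 + w ^ 2)] expresses the second derivative of [h] by
    the first, so it inherits the differentiability of [slope]. *)
Lemma continuous_slope_derivative (x : R) :
  continuous (fun t => / (1 + slope t ^ 2)) x.
Proof.
  apply @ex_derive_continuous.
  auto_derive. split; [eexists; apply is_derive_slope | split; [nra | exact I]].
Qed.

(** * A non-affine solution on the whole plane *)

Theorem mainTheorem1 :
  let u : R -> R -> R := fun x y => h x - h y in
  class_C 2 u
  /\ ~ affine_linear u
  /\ (forall x y : R,
        (1 + dx u x y ^ 2) * dx (dx u) x y
        + 2 * dx u x y * dy u x y * dy (dx u) x y
        + (1 + dy u x y ^ 2) * dy (dy u) x y = 0)
  /\ ~ bernstein_property
         (fun _ _ _ ux uy uxx uxy uyy : R =>
            (1 + ux ^ 2) * uxx + 2 * ux * uy * uxy + (1 + uy ^ 2) * uyy).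
Proof.
  intros u.
  assert (HC : class_C 2 u).
  { exact (difference_class_C2 _ _ _ is_derive_h is_derive_slope
             continuous_slope_derivative). }
  assert (Hna : ~ affine_linear u).
  { intros Ha.
    pose proof (difference_affine_linear _ _ _ is_derive_h is_derive_slope Ha 0)
      as H0. simpl in H0.
    revert H0. apply Rinv_neq_0_compat. nra. }
  assert (Heq : forall x y : R,
        (1 + dx u x y ^ 2) * dx (dx u) x y
        + 2 * dx u x y * dy u x y * dy (dx u) x y
        + (1 + dy u x y ^ 2) * dy (dy u) x y = 0).
  { intros x y. unfold u.
    rewrite (dxx_difference _ _ _ is_derive_h is_derive_slope),
      (dyx_difference _ _ is_derive_h),
      (dyy_difference _ _ _ is_derive_h is_derive_slope),
      (dx_difference _ _ is_derive_h), (dy_difference _ _ is_derive_h).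
    field. split; nra. }
  split; [exact HC | split; [exact Hna | split; [exact Heq |]]].
  intros HB. apply Hna, HB; [exact HC | exact Heq].
Qed.
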